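(* Let $\alpha=(s,u,t,v,\lambda,\varepsilon)$ with $s,u,t,v\in\mathbb C^\times$, $\lambda,\varepsilon\in\mathbb R$, and let $x,y\in\mathbb C^\times$ satisfy $0<|ux|,|u/x|,|vy|,|v/y|\le q^2$ and $0<|s/u|,|t/v|\le q$. Then $$\Phi_\alpha(x,y)=\overline{\Phi_{\bar\alpha^\vartheta}(\bar y,\bar x)}.$$
   Context: Fix $q\in(0,1)$. $(x;q)_\infty=\prod_{k\ge0}(1-xq^k)$, $\theta(x;q)=(x;q)_\infty(q/x;q)_\infty$; several arguments mean products, and $\pm$ in exponents means the product over all sign choices. For $\alpha=(s,u,t,v,\lambda,\varepsilon)$ let $\alpha^\vartheta=(t,v,s,u,\lambda,-\varepsilon)$ and $\bar\alpha=(\bar s,\bar u,\bar t,\bar v,\lambda,\varepsilon)$; $\bar\alpha^\vartheta=(\bar\alpha)^\vartheta=\overline{\alpha^\vartheta}$. Define $$f_{x,\alpha}(z)=\frac{(sq^{1-2i\lambda}x^{\pm1},uszq^{1+i\lambda};q^2)_\infty\,\theta(q^{2\varepsilon-i\lambda}uz/s;q^2)}{(uzq^{-i\lambda}x^{\pm1},sq^{1-i\lambda}/uz;q^2)_\infty}.$$ Let $\langle f,g\rangle=\frac1{2\pi i}\int_{\mathbb T}f(z)\overline{g(\bar z^{-1})}\frac{dz}z$, with $\mathbb T$ the positively oriented unit circle. Under the stated inequalities, the overlap coefficient is $\Phi_\alpha(x,y)=\langle f_{x,\alpha},g\rangle$ where $g(z)=f_{\bar y,\bar\alpha^\vartheta}(1/z)$.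 *)

(* Defs.v *)
From Stdlib Require Import Reals.
From Coquelicot Require Import Coquelicot.

Open Scope C_scope.

(* [q^w = exp (w ln q)] for a positive real base [q] and a complex exponent. *)
Definition qpow (q : R) (w : C) : C :=
  ((exp (Re w * ln q) * cos (Im w * ln q))%R,
   (exp (Re w * ln q) * sin (Im w * ln q))%R).

(* [\prod_(k < n) (1 - x p^k)] *)
Fixpoint qpoch_part (x : C) (p : R) (n : nat) : C :=
  match n with
  | O => 1
  | S k => qpoch_part x p k * (1 - x * RtoC (p ^ k))
  end.

(* [(x; p)_oo]; [lim] is total, and is the limit of the partial products
   whenever they converge, which is the case for every [x] when [|p| < 1]. *)
Definition qpoch (x : C) (p : R) : C :=
  lim (T := C_R_CompleteNormedModule) (filtermap (qpoch_part x p) eventually).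

Definition theta (x : C) (p : R) : C := qpoch x p * qpoch (RtoC p / x) p.

Record params := Params
  { ps : C; pu : C; pt : C; pv : C; plam : R; peps : R }.

Definition params_theta (a : params) : params :=
  Params (pt a) (pv a) (ps a) (pu a) (plam a) (- peps a).

Definition params_conj (a : params) : params :=
  Params (Cconj (ps a)) (Cconj (pu a)) (Cconj (pt a)) (Cconj (pv a))
         (plam a) (peps a).

Definition ffun (q : R) (x : C) (a : params) (z : C) : C :=
  let s := ps a in
  let u := pu a in
  let il := Ci * RtoC (plam a) in
  let eps := RtoC (peps a) in
  let p := (q ^ 2)%R in
  (qpoch (s * qpow q (1 - 2 * il) * x) p
   * qpoch (s * qpow q (1 - 2 * il) / x) p
   * qpoch (u * s * z * qpow q (1 + il)) p
   * theta (qpow q (2 * eps - il) * u * z / s) p)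
  / (qpoch (u * z * qpow q (- il) * x) p
     * qpoch (u * z * qpow q (- il) / x) p
     * qpoch (s * qpow q (1 - il) / (u * z)) p).

Definition unit_circle (phi : R) : C := (cos phi, sin phi).

(* Contour integral of [F] along the positively oriented unit circle
   [z = exp (i phi)], for which [dz = i z dphi]. *)
Definition circle_int (F : C -> C) : C :=
  RInt (V := C_R_CompleteNormedModule)
    (fun phi => F (unit_circle phi) * (Ci * unit_circle phi)) 0 (2 * PI).

Definition pairing (f g : C -> C) : C :=
  / (2 * RtoC PI * Ci) * circle_int (fun z => f z * Cconj (g (/ Cconj z)) / z).

Definition overlap (q : R) (a : params) (x y : C) : C :=
  pairing (ffun q x a)
    (fun z => ffun q (Cconj y) (params_theta (params_conj a)) (1 / z)).

(* Main.v *)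
Require Import Defs.
From Stdlib Require Import Reals Lra Classical FunctionalExtensionality.
From Coquelicot Require Import Coquelicot.

Open Scope C_scope.

(** Write [F] for [f_{x,alpha}] and [G] for the function with parameters
    [conj y] and [conj alpha^theta].  Since [(alpha^theta)^theta = alpha] and
    conjugation is an involution commuting with [theta], the two overlap
    coefficients are [<F, G o inv>] and [<G, F o inv>], where [inv z = 1/z].
    On the unit circle [inv] is complex conjugation, so the first integral has
    the density [F z * conj (G (conj z))] against [dz / z], and the second one,
    once conjugated, has this same density evaluated at [conj z].  The
    substitution [z -> conj z], that is [phi -> 2 PI - phi], exchanges them.

    The argument is therefore an identity between pairings of two arbitrary
    functions ([pairing_inv_exchange]).  The substitution and the conjugation
    act on the integral over [[0, 2 PI]] through a single involution ([skew])
    of the integrands.  As it is an involution, it preserves integrability in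
    both directions; and the integral of a function that is not integrable has
    the default value 0, which conjugation fixes.  Hence the identity of
    integrals ([RInt_skew]) holds for every integrand. *)

(** The value of a divergent integral comes from the total limit operator:
    every set belongs to the family of which the limit is taken, so each
    coordinate is the real value of the supremum [+oo], namely 0. *)
Lemma RInt_C_not_integrable (f : R -> C) (a b : R) :
  ~ ex_RInt (V := C_R_CompleteNormedModule) f a b ->
  RInt (V := C_R_CompleteNormedModule) f a b = RtoC 0.
Proof.
intros Hf.
assert (Hlub : forall P : R -> Prop, (forall x, P x) -> real (Lub_Rbar P) = 0%R).
{ intros P HP.
  rewrite (is_lub_Rbar_unique P p_infty); [reflexivity|].
  split; [intros x _; exact I|].
  intros [r| |] Hr; simpl; trivial.
  - specialize (Hr (r + 1)%R (HP _)); simpl in Hr; lra.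
  - exact (Hr 0%R (HP _)). }
change (RInt (V := C_R_CompleteNormedModule) f a b)
  with (C_complete_lim (fun A => forall l, is_RInt (V := C_R_NormedModule) f a b l -> A l)).
unfold C_complete_lim, R_complete_lim.
rewrite 2!Hlub; [reflexivity| |];
  intros x l Hl; destruct Hf; exists l; exact Hl.
Qed.

Lemma is_RInt_conj (f : R -> C) (a b : R) (l : C) :
  is_RInt (V := C_R_NormedModule) f a b l ->
  is_RInt (V := C_R_NormedModule) (fun t => Cconj (f t)) a b (Cconj l).
Proof.
intros Hf.
apply (is_RInt_fct_extend_pair (U := R_NormedModule) (V := R_NormedModule)).
- exact (is_RInt_fct_extend_fst (U := R_NormedModule) (V := R_NormedModule) _ _ _ _ Hf).
- apply (is_RInt_opp (V := R_NormedModule) (fun t => snd (f t)) a b (snd l)).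
  exact (is_RInt_fct_extend_snd (U := R_NormedModule) (V := R_NormedModule) _ _ _ _ Hf).
Qed.

(** The action of [z -> conj z] on an integrand pulled back to the angle,
    followed by complex conjugation of the values.  The sign is that of
    [dz / z = i dphi], whose factor [i] satisfies [conj i = - i]. *)
Definition skew (h : R -> C) (phi : R) : C := - Cconj (h (2 * PI - phi)%R).

Lemma skew_involutive (h : R -> C) : skew (skew h) = h.
Proof.
apply functional_extensionality; intros phi; unfold skew.
replace (2 * PI - (2 * PI - phi))%R with phi by ring.
rewrite Copp_conj, Cconj_conj; ring.
Qed.

Lemma is_RInt_skew (h : R -> C) (l : C) :
  is_RInt (V := C_R_NormedModule) h 0 (2 * PI) l ->
  is_RInt (V := C_R_NormedModule) (skew h) 0 (2 * PI) (- Cconj l).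
Proof.
intros Hh.
(* Reversing the interval and substituting with slope -1 each give a sign;
   the first one is the sign of [- Cconj l], the second one that of [skew]. *)
assert (Hrev : is_RInt (V := C_R_NormedModule)
                 (fun phi => Cconj (h phi)) (-1 * 0 + 2 * PI) (-1 * (2 * PI) + 2 * PI)
                 (opp (Cconj l))).
{ replace (-1 * 0 + 2 * PI)%R with (2 * PI)%R by ring.
  replace (-1 * (2 * PI) + 2 * PI)%R with 0%R by ring.
  apply (is_RInt_swap (V := C_R_NormedModule)), is_RInt_conj, Hh. }
apply (is_RInt_comp_lin (V := C_R_NormedModule)) in Hrev.
refine (is_RInt_ext (V := C_R_NormedModule) _ _ _ _ _ _ Hrev).
intros phi _; unfold skew.
replace (-1 * phi + 2 * PI)%R with (2 * PI - phi)%R by ring.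
exact (scal_opp_one (V := C_R_NormedModule) (Cconj (h (2 * PI - phi)%R))).
Qed.

Lemma RInt_skew (h : R -> C) :
  RInt (V := C_R_CompleteNormedModule) (skew h) 0 (2 * PI) =
  - Cconj (RInt (V := C_R_CompleteNormedModule) h 0 (2 * PI)).
Proof.
destruct (classic (ex_RInt (V := C_R_CompleteNormedModule) h 0 (2 * PI)))
  as [[l Hl]|Hh].
- rewrite (is_RInt_unique (V := C_R_CompleteNormedModule) _ _ _ _ Hl).
  apply (is_RInt_unique (V := C_R_CompleteNormedModule)).
  exact (is_RInt_skew h l Hl).
- rewrite (RInt_C_not_integrable h), RInt_C_not_integrable; trivial.
  + apply injective_projections; simpl; ring.
  + intros [l Hl]; apply Hh; exists (- Cconj l).
    rewrite <- (skew_involutive h); exact (is_RInt_skew _ _ Hl).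
Qed.

Lemma unit_circle_neq_0 (phi : R) : unit_circle phi <> 0.
Proof.
intros H; injection H as Hcos Hsin.
generalize (sin2_cos2 phi); rewrite Hcos, Hsin; unfold Rsqr; lra.
Qed.

Lemma Cconj_neq_0 (z : C) : z <> 0 -> Cconj z <> 0.
Proof. intros Hz; apply Cmod_gt_0; rewrite Cmod_conj; apply Cmod_gt_0, Hz. Qed.

Lemma unit_circle_reflect (phi : R) :
  unit_circle (2 * PI - phi) = Cconj (unit_circle phi).
Proof.
unfold unit_circle, Cconj; simpl.
replace (2 * PI - phi)%R with (- phi + 2 * PI)%R by ring.
rewrite cos_plus, sin_plus, cos_2PI, sin_2PI, cos_neg, sin_neg.
f_equal; ring.
Qed.

(** Hermitian symmetry of the pairing, [<f, g> = conj <g, f>], combined with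
    the invariance of [dz / z] on the circle under [z -> 1/z]. *)
Lemma pairing_inv_exchange (F G : C -> C) :
  pairing F (fun z => G (1 / z)) = Cconj (pairing G (fun z => F (1 / z))).
Proof.
assert (Hinv : forall phi, 1 / / Cconj (unit_circle phi) = Cconj (unit_circle phi)).
{ intros phi; field; apply Cconj_neq_0, unit_circle_neq_0. }
assert (H2pi : 2 * RtoC PI <> 0).
{ rewrite <- RtoC_mult; intros H; injection H; generalize PI_RGT_0; lra. }
assert (HCi : Ci <> 0) by (intros H; injection H; lra).
assert (Hi : Cconj Ci = - Ci) by (apply injective_projections; simpl; ring).
assert (Hc : Cconj (2 * RtoC PI * Ci) = - (2 * RtoC PI * Ci)).
{ apply injective_projections; simpl; ring. }
assert (Hcirc :
  circle_int (fun z => F z * Cconj (G (1 / / Cconj z)) / z) =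
  - Cconj (circle_int (fun z => G z * Cconj (F (1 / / Cconj z)) / z))).
{ unfold circle_int; rewrite <- RInt_skew.
  apply (RInt_ext (V := C_R_CompleteNormedModule)); intros phi _.
  unfold skew; rewrite !Hinv, unit_circle_reflect.
  pose proof (unit_circle_neq_0 phi) as Hz.
  pose proof (Cconj_neq_0 _ Hz) as Hz'.
  rewrite !Cmult_conj, Cdiv_conj, !Cmult_conj, !Cconj_conj, Hi by assumption.
  match goal with |- ?l = ?r => change (@eq C l r) end; field; exact Hz. }
unfold pairing; rewrite Hcirc, Cmult_conj, Cinv_conj, Hc by (apply Cmult_neq_0; assumption).
field; split; trivial.
intros H; apply H2pi; rewrite H; ring.
Qed.

Lemma params_conj_theta_involutive (a : params) :
  params_theta (params_conj (params_theta (params_conj a))) = a.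
Proof.
destruct a; unfold params_theta, params_conj; simpl.
rewrite !Cconj_conj, Ropp_involutive; reflexivity.
Qed.

Theorem proposition3p7 (q : R) (hq : (0 < q < 1)%R)
  (s u t v : C) (lam eps : R) (x y : C)
  (hs : s <> 0) (hu : u <> 0) (ht : t <> 0) (hv : v <> 0)
  (hx : x <> 0) (hy : y <> 0)
  (hux : (0 < Cmod (u * x) <= q ^ 2)%R)
  (hu_x : (0 < Cmod (u / x) <= q ^ 2)%R)
  (hvy : (0 < Cmod (v * y) <= q ^ 2)%R)
  (hv_y : (0 < Cmod (v / y) <= q ^ 2)%R)
  (hsu : (0 < Cmod (s / u) <= q)%R)
  (htv : (0 < Cmod (t / v) <= q)%R) :
  let a := Params s u t v lam eps in
  overlap q a x y =
  Cconj (overlap q (params_theta (params_conj a)) (Cconj y) (Cconj x)).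
Proof.
intros a; unfold overlap.
rewrite params_conj_theta_involutive, Cconj_conj.
apply pairing_inv_exchange.
Qed.
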